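(* Let $(S,\mathcal B_S,\mu)$ be a standard Lebesgue space with $\sigma$-finite measure $\mu$, and $f,g:S\to[0,\infty)$ measurable with $\int_S f\,d\mu=\int_S g\,d\mu=1$. Let $(X,Y)$ satisfy \[ \mathbb P(X\le x,Y\le y)=\exp\Big\{-\int_S \max\Big(\frac{f(s)}{x},\frac{g(s)}{y}\Big)\mu(ds)\Big\},\qquad x,y>0 . \] Let $E_t=\{s\in S: f(s)>t\,g(s)\}$ and define $\gamma(t)=\frac1t\int_S f\,\mathbf 1_{\{f>tg\}}\,d\mu$. Suppose $\mu(E_t)>0$ for all $t\in(0,\infty)$. For $u\ge0$ put $X(u)=\max(X,u)$, $Y(u)=\max(Y,u)$. Then, for $\alpha\ge 0$, $X(u)/Y(u)\in RV_{-\alpha}$ for some $u\ge0$ if and only if $X(u)/Y(u)\in RV_{-\alpha}$ for all $u\ge 0$, if and only if $\gamma\in RV_{-\alpha}$.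
   Context: A measurable $U:\mathbb R_+\to\mathbb R_+$ is in $RV_{-\rho}$ if $U(tx)/U(t)\to x^{-\rho}$ as $t\to\infty$ for all $x>0$; a nonnegative random variable $Z$ is in $RV_{-\rho}$ if $t\mapsto\mathbb P(Z>t)$ is in $RV_{-\rho}$. Convention $1/0=\infty$, $X(0)=X$. *)

(* Defs.v *)
From HB Require Import structures.
From mathcomp Require Import all_boot all_order all_algebra.
From mathcomp Require Import all_classical all_reals all_analysis.
Set Implicit Arguments. Unset Strict Implicit. Unset Printing Implicit Defensive.
Import Order.TTheory GRing.Theory Num.Theory.
Import numFieldNormedType.Exports.
Local Open Scope classical_set_scope.
Local Open Scope ring_scope.

Definition regvar (R : realType) (rho : R) (U : R -> R) : Prop :=
  measurable_fun [set t : R | 0 < t] U /\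
  (forall t : R, 0 < t -> 0 <= U t) /\
  (forall x : R, 0 < x ->
     (fun t : R => U (t * x) / U t) @ +oo --> x `^ (- rho)).

(* Tail function t |-> P(X(u)/Y(u) > t), with X(u) = max(X,u), Y(u) = max(Y,u).
   The event {X(u)/Y(u) > t} is written {X(u) > t * Y(u)}, which agrees with
   the convention 1/0 = oo (for t >= 0) whenever Y(u) = 0 < X(u). *)
Definition ratio_tail (R : realType) (dO : measure_display) (Omega : measurableType dO)
  (P : probability Omega R) (X Y : Omega -> R) (u : R) (t : R) : R :=
  fine (P [set w | t * Num.max (Y w) u < Num.max (X w) u]).

Definition gamma_fun (R : realType) (dS : measure_display) (S : measurableType dS)
  (mu : {measure set S -> \bar R}) (f g : S -> R) (t : R) : R :=
  t^-1 * Rintegral mu [set s | t * g s < f s] f.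

(* Main.v *)
Require Import Defs.
From HB Require Import structures.
From mathcomp Require Import all_boot all_order all_algebra.
From mathcomp Require Import all_classical all_reals all_analysis.
From mathcomp Require Import measurable_realfun.
From mathcomp Require Import ring lra.
Set Implicit Arguments. Unset Strict Implicit.
Import Order.TTheory GRing.Theory Num.Theory.
Import numFieldNormedType.Exports.
Local Open Scope classical_set_scope.
Local Open Scope ring_scope.

(** Write [V(x,y)] for the exponent in the joint law, [W t = V(t,1)] and
    [Q t] for the integral of [f] over [{f > t g}], so that [gamma t = Q t / t]
    and [V(x,y) = W(x/y)/y].  For fixed [t >= 1] put
    [phi u = P(X > t max(Y,u))].  On a cell [a < b = q a] the increment
    [phi a - phi b] is the mass of the part of [{X > t Y}] with [ta < X <= tb],
    which lies between two rectangle probabilities given by the joint law.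
    Since the slope of [W] in [1/t] is [Q], that increment is, up to a factor
    tending to [1] as [q] decreases to [1], [gamma t / W t] times the increment
    of [exp(- W t / .)].  Summing over the cells of the geometric grid
    [u, q u, q^2 u, ...] and letting [q] decrease to [1] gives
      [gamma t / (1 + 1/t) * (1 - exp(-1/u)) <= phi u
         <= gamma t * (1 - exp(-(1 + 1/t)/u))]
    because [1 <= W t <= 1 + 1/t].  Hence the tail of [X(u)/Y(u)] is
    asymptotic to a positive multiple of [gamma] for every [u], the case
    [u = 0] being the limit of small [u], and regular variation transfers. *)

(** * Regular variation of asymptotically proportional functions *)

Lemma regvar_of_ratio_cvg (R : realType) (rho c : R) (U V : R -> R) :
  0 < c -> measurable_fun [set t : R | 0 < t] U ->
  (forall t, 0 < t -> 0 <= U t) -> (\forall t \near +oo, V t != 0) ->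
  (fun t => U t / V t) @ +oo --> c -> regvar rho V -> regvar rho U.
Proof.
move=> c0 mU U0 V0 UVc [_ [_ V_rv]]; split=> //; split=> // x x0.
have scale_pinfty : (fun t : R => t * x) @ +oo --> +oo.
  exact: gt0_cvgMly.
have scaled : (fun t => U (t * x) / V (t * x)) @ +oo --> c.
  exact: (cvg_comp _ _ scale_pinfty UVc).
have scaledV0 : \forall t \near +oo, V (t * x) != 0.
  exact: (scale_pinfty _ V0).
(* The limit is split to match the factorisation of [U (t * x) / U t] into [U (t * x) / V (t * x)],
   [V (t * x) / V t] and the inverse of [U t / V t], with limits [c], the power of [x], and
   [c^-1]. *)
have -> : x `^ (- rho) = c * x `^ (- rho) * c^-1.
  by rewrite mulrAC divff ?mul1r// gt_eqF.
apply: cvg_trans (cvgM (cvgM scaled (V_rv x x0)) (cvgV _ UVc)); last first.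
  by rewrite gt_eqF.
apply: near_eq_cvg; near=> t => /=.
have Vt : V t != 0 by near: t.
have Vtx : V (t * x) != 0 by near: t.
rewrite invf_div -!mulrA (mulKf Vtx) (mulKf Vt)//.
Unshelve. all: by end_near. Qed.

(** The previous transfer is used in both directions. For the reverse one [U] must be eventually
    nonzero: [U t = 0] would make the ratio [0], whereas the ratio is eventually positive because
    [c > 0]. *)
Lemma regvar_equiv (R : realType) (rho c : R) (U V : R -> R) :
  0 < c -> measurable_fun [set t : R | 0 < t] U ->
  measurable_fun [set t : R | 0 < t] V ->
  (forall t, 0 < t -> 0 <= U t) -> (forall t, 0 < t -> 0 < V t) ->
  (fun t => U t / V t) @ +oo --> c -> regvar rho U <-> regvar rho V.
Proof.
move=> c0 mU mV U0 V0 UVc; split.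
- apply: (@regvar_of_ratio_cvg _ _ c^-1) => //.
  + by rewrite invr_gt0.
  + by move=> t /V0/ltW.
  + near=> t; have : 0 < U t / V t.
      by near: t; exact: (cvgr_gt c).
    by apply: contraTneq => ->; rewrite mul0r ltxx.
  + rewrite (_ : (fun t => V t / U t) = (fun t => (U t / V t)^-1)).
      by apply: cvgV UVc; rewrite gt_eqF.
    by apply/funext => t /=; rewrite invf_div.
- apply: (@regvar_of_ratio_cvg _ _ c) => //.
  by near=> t; rewrite gt_eqF// V0//; near: t; exact: nbhs_pinfty_gt.
Unshelve. all: by end_near. Qed.

(** Chaining the one-cell inequality gives [G (q ^+ n * u) <= G u] for every [n], and the grid runs
    to infinity because [q > 1]. Summation over the cells thus becomes monotonicity of a single
    function, with no series to handle. *)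
Lemma geometric_grid_le (R : realType) (G : R -> R) (q u l : R) :
  0 < u -> 1 < q -> (forall a, u <= a -> G (q * a) <= G a) ->
  G @ +oo --> l -> l <= G u.
Proof.
move=> u0 q1 Gq Gl.
have q0 : 0 < q by apply: lt_trans q1.
have grid n : u <= q ^+ n * u /\ G (q ^+ n * u) <= G u.
  elim: n => [|n [un Gn]]; first by rewrite expr0 mul1r.
  rewrite exprS -mulrA; split; last exact: le_trans (Gq _ un) Gn.
  by rewrite (le_trans un)// ler_peMl ?(ltW q1)// (le_trans (ltW u0) un).
have powy : (fun n => q ^+ n) @ \oo --> +oo.
  apply/(gtr0_cvgV0 (f := fun n => q ^+ n)).
    by apply: nearW => n; rewrite exprn_gt0.
  apply: cvg_trans (@cvg_expr _ q^-1 _); last first.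
    by rewrite gtr0_norm ?invr_gt0// invf_lt1.
  by apply: near_eq_cvg; near=> n => /=; rewrite exprVn.
have muly : (fun x : R => x * u) @ +oo --> +oo by exact: gt0_cvgMly.
have gridy := cvg_comp _ _ powy muly.
apply: (cvgr_to_le (cvg_comp _ _ gridy Gl)).
by apply: nearW => n; have [] := grid n.
Unshelve. all: by end_near. Qed.

(** * The exponent function of the joint law and its slope *)

Section exponent_measure.
Context (R : realType) (dS : measure_display) (S : measurableType dS).
Context (mu : {measure set S -> \bar R}) (f g : S -> R).
Context (mf : measurable_fun setT f) (mg : measurable_fun setT g).
Context (f0 : forall s, 0 <= f s) (g0 : forall s, 0 <= g s).
Context (intf : (\int[mu]_s (f s)%:E = 1)%E) (intg : (\int[mu]_s (g s)%:E = 1)%E).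

Definition exponent (t : R) : R :=
  Rintegral mu setT (fun s => Num.max (f s / t) (g s)).

Definition excess (t : R) : R := Rintegral mu [set s | t * g s < f s] f.

Lemma integrable_of_integral1 (h : S -> R) : measurable_fun setT h ->
  (forall s, 0 <= h s) -> (\int[mu]_s (h s)%:E = 1)%E ->
  mu.-integrable setT (EFin \o h).
Proof.
move=> mh h0 inth; apply/integrableP; split; first exact/measurable_EFinP.
under eq_integral => s _ do rewrite /= ger0_norm//.
by rewrite inth ltry.
Qed.

Let fint := integrable_of_integral1 mf f0 intf.
Let gint := integrable_of_integral1 mg g0 intg.

Lemma integrable_exponent (t : R) : 0 < t ->
  mu.-integrable setT (EFin \o (fun s => Num.max (f s / t) (g s))).
Proof.
move=> t0.
have hint : mu.-integrable setT (EFin \o (fun s => f s / t + g s)).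
  have ft : mu.-integrable setT (fun s => (f s)%:E * (t^-1)%:E)%E.
    exact: integrableZr.
  by have := integrableD measurableT ft gint; apply: eq_integrable.
apply: le_integrable hint => //.
- apply/measurable_EFinP; apply: measurable_maxr => //.
  exact: measurable_funM.
- move=> s _ /=; have ft : 0 <= f s / t by rewrite divr_ge0// ltW.
  rewrite lee_fin !ger0_norm ?addr_ge0// ?le_max ?ft//.
  by rewrite ge_max lerDl lerDr ft g0.
Qed.

Lemma exponent_homogeneous (x y : R) : 0 < x -> 0 < y ->
  Rintegral mu setT (fun s => Num.max (f s / x) (g s / y)) =
  exponent (x / y) / y.
Proof.
move=> x0 y0; rewrite /exponent -RintegralZr//; last first.
  by apply: integrable_exponent; rewrite divr_gt0.
apply: eq_Rintegral => s _.
rewrite maxr_pMl ?invr_ge0 ?(ltW y0)//; congr Num.max.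
by field; rewrite !gt_eqF.
Qed.

Lemma exponent_ge1 (t : R) : 0 < t -> 1 <= exponent t.
Proof.
move=> t0; have -> : 1 = Rintegral mu setT g by rewrite /Rintegral intg.
apply: le_Rintegral => //; first exact: integrable_exponent.
by move=> s _; rewrite le_max lexx orbT.
Qed.

Lemma exponent_le (t : R) : 0 < t -> exponent t <= 1 + t^-1.
Proof.
move=> t0.
have ft : mu.-integrable setT (EFin \o (fun s => f s / t)).
  by apply: eq_integrable (integrableZr measurableT t^-1 fint).
have -> : 1 + t^-1 = Rintegral mu setT (fun s => f s / t + g s).
  rewrite RintegralD// RintegralZr// addrC /Rintegral intf intg mul1r //.
apply: le_Rintegral => //; first exact: integrable_exponent.
  by have := integrableD measurableT ft gint; apply: eq_integrable.
move=> s _; have ft0 : 0 <= f s / t by rewrite divr_ge0// ltW.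
by rewrite ge_max lerDl lerDr ft0 g0.
Qed.

Lemma measurable_excess_set (t : R) : measurable [set s | t * g s < f s].
Proof.
have := measurable_fun_ltr (measurable_funM (@measurable_cst _ _ _ _ setT t) mg) mf.
by move=> /(_ measurableT [set true]); rewrite setTI; apply.
Qed.

(** The integrand is extended by [0] to all of [S], so that comparisons with [exponent] reduce to
    pointwise inequalities between integrands on one domain. *)
Let excess_density (t : R) (s : S) : R := if t * g s < f s then f s else 0.

Lemma excess_densityE (t : R) :
  f \_ [set s | t * g s < f s] = excess_density t.
Proof.
apply/funext => s; rewrite patchE (_ : (s \in _) = (t * g s < f s))//.
by apply/idP/idP => [/set_mem|?]//; exact/mem_set.
Qed.

Lemma integrable_excess (t : R) : mu.-integrable setT (EFin \o excess_density t).
Proof.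
rewrite -excess_densityE -restrict_EFin.
apply: (iffLR (integrable_mkcond _ (measurable_excess_set t))).
exact: integrableS (measurable_excess_set t) _ fint.
Qed.

Lemma excessE (t : R) : excess t = Rintegral mu setT (excess_density t).
Proof. by rewrite -excess_densityE; exact: Rintegral_mkcond. Qed.

(* [exponent] is convex in [1/t], and [excess] is its slope. *)
Lemma exponent_sub_ge (t s : R) : 0 < t -> t < s ->
  excess s * (t^-1 - s^-1) <= exponent t - exponent s.
Proof.
move=> t0 ts; have s0 := lt_trans t0 ts.
have ts' : s^-1 < t^-1 by rewrite ltf_pV2.
have et := integrable_exponent t0; have es := integrable_exponent s0.
rewrite excessE -RintegralZr//; last exact: integrable_excess.
rewrite /exponent -RintegralB//; apply: le_Rintegral => //.
- by have := integrableZr measurableT (t^-1 - s^-1) (integrable_excess s);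
    apply: eq_integrable.
- by have := integrableB measurableT et es; apply: eq_integrable.
move=> w _; rewrite /excess_density.
have le_st : f w / s <= f w / t by rewrite ler_wpM2l// ltW.
(* On [f > s g] both maxima are the multiples of [f] and equality holds; elsewhere the left side is
   [0] and the maximum decreases in the parameter. *)
case: ltP => [gw|_]; last first.
  by rewrite mul0r subr_ge0 ge_max !le_max le_st lexx orbT.
have /ltW gs : g w < f w / s by rewrite ltr_pdivlMr// mulrC.
by rewrite !max_l ?(le_trans gs)// mulrBr.
Qed.

(** The slope is now taken at the smaller parameter [t]. Where [f <= t g] both maxima equal [g] and
    nothing is lost; where [f > t g] the first maximum is [f / t] and the second is at least
    [f / s]. *)
Lemma exponent_sub_le (t s : R) : 0 < t -> t < s ->
  exponent t - exponent s <= excess t * (t^-1 - s^-1).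
Proof.
move=> t0 ts; have s0 := lt_trans t0 ts.
have ts' : s^-1 < t^-1 by rewrite ltf_pV2.
have et := integrable_exponent t0; have es := integrable_exponent s0.
rewrite excessE -RintegralZr//; last exact: integrable_excess.
rewrite /exponent -RintegralB//; apply: le_Rintegral => //.
- by have := integrableB measurableT et es; apply: eq_integrable.
- by have := integrableZr measurableT (t^-1 - s^-1) (integrable_excess t);
    apply: eq_integrable.
move=> w _; rewrite /excess_density.
have le_st : f w / s <= f w / t by rewrite ler_wpM2l// ltW.
case: ltP => [gw|gw].
  have /ltW gt : g w < f w / t by rewrite ltr_pdivlMr// mulrC.
  by rewrite max_l// mulrBr lerD2l lerN2 le_max lexx.
have gt : f w / t <= g w by rewrite ler_pdivrMr// mulrC.
by rewrite mul0r !max_r ?(le_trans le_st)// subrr.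
Qed.

Lemma excess_ge0 (t : R) : 0 <= excess t.
Proof. by apply: Rintegral_ge0. Qed.

Lemma excess_nonincreasing : nonincreasing_fun excess.
Proof.
move=> t s ts; rewrite !excessE; apply: le_Rintegral => //.
- exact: integrable_excess.
- exact: integrable_excess.
move=> w _; rewrite /excess_density.
case: (ltP (s * g w)) => [gw|_]; last by case: ifP.
by rewrite ifT// (le_lt_trans _ gw)// ler_wpM2r.
Qed.

(** If the integral vanished, [f] would be [0] almost everywhere on the set; but there
    [f > t g >= 0], so the set would be null. *)
Lemma excess_gt0 (t : R) : 0 < t ->
  (0%E < mu [set s | t * g s < f s])%O -> 0 < excess t.
Proof.
move=> t0 muE; rewrite lt_neqAle excess_ge0 andbT.
apply/eqP => /esym ex0.
have mE := measurable_excess_set t.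
have Eint : mu.-integrable [set s | t * g s < f s] (EFin \o f).
  exact: integrableS mE _ fint.
have fin := integrable_fin_num mE Eint.
have int0 : (\int[mu]_(s in [set s | (t * g s < f s)%R]) `|(EFin \o f) s| = 0)%E.
  under eq_integral => s _ do rewrite gee0_abs ?lee_fin//.
  by rewrite -[LHS]fineK// [fine _]ex0.
have [+ _] := ae_eq_integral_abs mu mE (measurable_int mu Eint).
move=> /(_ int0)[N [mN N0 EN]].
move: muE; rewrite ltNge => /negP; apply; rewrite -N0.
apply: le_measure; [exact: mem_set| exact: mem_set|].
move=> s /= Es; apply: EN => /= fs0.
have [fs] := fs0 Es; move: Es.
by rewrite fs ltNge mulr_ge0// (ltW t0).
Qed.

(** Since the inequality defining the set is strict, the sets at levels [t * q n] increase to the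
    set at level [t], and monotone convergence applies. *)
Lemma excess_cvg_right (t : R) (q : R^nat) : 0 < t ->
  (forall n, 1 < q n) -> {homo q : m n / (m <= n)%N >-> n <= m} ->
  q @ \oo --> (1 : R) -> (fun n => excess (t * q n)) @ \oo --> excess t.
Proof.
move=> t0 q1 qni ql.
pose F n := [set s | t * q n * g s < f s].
have FE : \bigcup_n F n = [set s | t * g s < f s].
  apply/seteqP; split=> [s [n _]|s /= gf].
    apply: le_lt_trans; rewrite -mulrA ler_wpM2l ?(ltW t0)//.
    by rewrite ler_peMl// ltW.
  have tql : (fun n => t * q n * g s) @ \oo --> t * g s.
    have -> : t * g s = t * 1 * g s by rewrite mulr1.
    by apply: cvgMr_tmp; apply: cvgMl_tmp.
  have [n _ /(_ n (leqnn n)) Fn] := cvgr_lt _ tql _ gf.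
  by exists n.
have intE : (\int[mu]_(s in \bigcup_n F n) (f s)%:E = (excess t)%:E)%E.
  rewrite FE /excess /Rintegral fineK//.
  apply: integrable_fin_num; first exact: measurable_excess_set.
  exact: integrableS (measurable_excess_set t) _ fint.
apply: fine_cvg; rewrite -intE.
apply: ge0_nondecreasing_set_cvg_integral.
- move=> m n mn; apply/subsetPset => s; rewrite /F /=.
  apply: le_lt_trans; rewrite ler_wpM2r// ler_wpM2l ?(ltW t0)//.
  exact: qni.
- by move=> n; exact: measurable_excess_set.
- by move=> n; apply: measurable_funTS; exact/measurable_EFinP.
- by move=> n s _; rewrite lee_fin.
Qed.
End exponent_measure.

(** The graph of [expR] lies above its tangent at [y]. Used at either end of an interval, this traps
    an exponential increment between two linear ones. *)
Lemma expR_sub_le (R : realType) (x y : R) :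
  expR y - expR x <= expR y * (y - x).
Proof.
have -> : expR x = expR y * expR (x - y) by rewrite -expRD addrC subrK.
rewrite -[X in X - _]mulr1 -mulrBr ler_pM2l ?expR_gt0//.
by have := expR_ge1Dx (x - y); lra.
Qed.

Lemma expR_sub_ge (R : realType) (x y : R) :
  expR x * (y - x) <= expR y - expR x.
Proof. by have := expR_sub_le y x; lra. Qed.

(** * The tail of the truncated ratio and its comparison with rectangles *)

Section ratio_tail.
Context (R : realType) (dO : measure_display) (Omega : measurableType dO).
Context (P : probability Omega R) (X Y : Omega -> R).
Context (mX : measurable_fun setT X) (mY : measurable_fun setT Y).

(** Additivity on the left and subadditivity on the right compare two differences of probabilities
    through an inclusion of unions, without forming set differences. *)
Lemma fine_probability_subU (A B C D : set Omega) :
  measurable A -> measurable B -> measurable C -> measurable D ->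
  A `&` B = set0 -> A `|` B `<=` C `|` D ->
  fine (P A) + fine (P B) <= fine (P C) + fine (P D).
Proof.
move=> mA mB mC mD AB0 ABCD.
rewrite -!fineD ?fin_num_measure// -measureU//.
rewrite fine_le ?fin_numD ?fin_num_measure//; first exact: measurableU.
apply: le_trans (measureU2 _ mC mD).
by apply: le_measure => //; rewrite inE; exact: measurableU.
Qed.

Lemma measurable_ratio_set (t u : R) :
  measurable [set w | t * Num.max (Y w) u < Num.max (X w) u].
Proof.
have mmax (Z : Omega -> R) : measurable_fun setT Z ->
    measurable_fun setT (fun w => Num.max (Z w) u).
  by move=> mZ; exact: measurable_maxr.
have := measurable_fun_ltr
  (measurable_funM (@measurable_cst _ _ _ _ setT t) (mmax _ mY)) (mmax _ mX).
by move=> /(_ measurableT [set true]); rewrite setTI; apply.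
Qed.

Lemma measurable_quadrant (x y : R) : measurable [set w | X w <= x /\ Y w <= y].
Proof.
have mle (Z : Omega -> R) z : measurable_fun setT Z ->
    measurable [set w | Z w <= z].
  move=> mZ; rewrite -[X in measurable X]setTI.
  exact: measurable_fun_le.
exact: measurableI (mle _ _ mX) (mle _ _ mY).
Qed.

(** As [t >= 1], the value [t * max(Y,u)] is at least [u], so only [X] itself can exceed it. This is
    where the restriction to [t >= 1] comes from. *)
Lemma ratio_setE (t u : R) : 1 <= t -> 0 <= u ->
  [set w | t * Num.max (Y w) u < Num.max (X w) u] =
  [set w | t * Num.max (Y w) u < X w].
Proof.
move=> t1 u0; apply/seteqP; split=> w /=; rewrite lt_max; last by move=> ->.
case/orP=> //; rewrite ltNge => /negP[].
have Yu : u <= Num.max (Y w) u by rewrite le_max lexx orbT.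
by rewrite (le_trans Yu)// ler_peMl// (le_trans u0).
Qed.

Lemma ratio_tail_ge0 (t u : R) : 0 <= ratio_tail P X Y u t.
Proof. exact: fine_ge0. Qed.

Lemma ratio_tail_nonincreasing (u : R) : 0 <= u ->
  nonincreasing_fun (ratio_tail P X Y u).
Proof.
move=> u0 s t st; rewrite fine_le ?fin_num_measure//.
1,2: exact: measurable_ratio_set.
apply: le_measure; rewrite ?inE; [exact: measurable_ratio_set..|].
move=> w /=; apply: le_lt_trans; rewrite ler_wpM2r//.
by rewrite le_max u0 orbT.
Qed.

Lemma ratio_tail_cvg_right (t u : R) (q : R^nat) : 0 < t -> 0 <= u ->
  (forall n, 1 < q n) -> {homo q : m n / (m <= n)%N >-> n <= m} ->
  q @ \oo --> (1 : R) ->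
  (fun n => ratio_tail P X Y u (t * q n)) @ \oo --> ratio_tail P X Y u t.
Proof.
move=> t0 u0 q1 qni ql.
have max0 w : 0 <= Num.max (Y w) u by rewrite le_max u0 orbT.
pose F n := [set w | t * q n * Num.max (Y w) u < Num.max (X w) u].
have FE : \bigcup_n F n = [set w | t * Num.max (Y w) u < Num.max (X w) u].
  apply/seteqP; split=> [w [n _]|w /= XY].
    apply: le_lt_trans; rewrite -mulrA ler_wpM2l ?(ltW t0)//.
    by rewrite ler_peMl// ltW.
  have tql : (fun n => t * q n * Num.max (Y w) u) @ \oo --> t * Num.max (Y w) u.
    have -> : t * Num.max (Y w) u = t * 1 * Num.max (Y w) u by rewrite mulr1.
    by apply: cvgMr_tmp; apply: cvgMl_tmp.
  have [n _ /(_ n (leqnn n)) Fn] := cvgr_lt _ tql _ XY.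
  by exists n.
apply: fine_cvg; rewrite fineK; last first.
  by rewrite fin_num_measure//; exact: measurable_ratio_set.
rewrite -FE; apply: nondecreasing_cvg_mu.
- by move=> n; exact: measurable_ratio_set.
- by rewrite FE; exact: measurable_ratio_set.
- move=> m n mn; apply/subsetPset => w; rewrite /F /=.
  apply: le_lt_trans; rewrite ler_wpM2r// ler_wpM2l ?(ltW t0)//.
  exact: qni.
Qed.

(** By [ratio_setE] the events increase as the truncation level decreases, so continuity from below
    applies. *)
Lemma ratio_tail_cvg0 (t : R) : 1 <= t ->
  (fun n => ratio_tail P X Y n.+1%:R^-1 t) @ \oo --> ratio_tail P X Y 0 t.
Proof.
move=> t1; have t0 : 0 < t := lt_le_trans ltr01 t1.
pose F n := [set w | t * Num.max (Y w) n.+1%:R^-1 < X w].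
have n0 n : 0 <= n.+1%:R^-1 :> R by rewrite invr_ge0.
have mF n : measurable (F n).
  by rewrite /F -ratio_setE//; exact: measurable_ratio_set.
have FE : \bigcup_n F n = [set w | t * Num.max (Y w) 0 < X w].
  apply/seteqP; split=> [w [n _]|w /= XY].
    apply: le_lt_trans; rewrite ler_pM2l// ge_max !le_max lexx/=.
    by rewrite n0 orbT.
  (* On the limit event [X w > 0], so some [n.+1%:R^-1] falls below [X w / t]; that truncation level
     keeps [w] in the event. *)
  have X0 : 0 < X w / t.
    by rewrite divr_gt0// (le_lt_trans _ XY)// mulr_ge0 ?(ltW t0)// le_max lexx orbT.
  have [n _ /(_ n (leqnn n)) Fn] := cvgr_lt _ (@cvg_harmonic R) _ X0.
  exists n => //; rewrite /F /= mulrC -ltr_pdivlMr// gt_max Fn andbT.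
  by rewrite ltr_pdivlMr// mulrC (le_lt_trans _ XY)// ler_pM2l// le_max lexx.
rewrite /ratio_tail ratio_setE//.
rewrite (_ : (fun n => _) = (fun n => fine (P (F n)))); last first.
  by apply/funext => n; rewrite ratio_setE.
apply: fine_cvg; rewrite fineK; last first.
  by rewrite fin_num_measure// -FE; exact: bigcup_measurable.
rewrite -FE; apply: nondecreasing_cvg_mu => //.
- exact: bigcup_measurable.
- move=> m n mn; apply/subsetPset => w; rewrite /F /=.
  apply: le_lt_trans; rewrite ler_pM2l// ge_max !le_max lexx/=.
  by rewrite lef_pV2 ?posrE// ler_nat ltnS mn orbT.
Qed.

Context (W : R -> R).
Context (jointW : forall x y : R, 0 < x -> 0 < y ->
  P [set w | X w <= x /\ Y w <= y] = (expR (- (W (x / y) / y)))%:E).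

(** The rectangle [ta < X <= tb], [Y <= a] lies in the tail event for [a] and misses the one for
    [b]. *)
Lemma ratio_tail_box_ge (t a b : R) : 1 <= t -> 0 < a -> a < b ->
  expR (- (W (t * b / a) / a)) - expR (- (W t / a)) <=
  ratio_tail P X Y a t - ratio_tail P X Y b t.
Proof.
move=> t1 a0 ab; have b0 := lt_trans a0 ab; have t0 : 0 < t := lt_le_trans ltr01 t1.
have := @fine_probability_subU
  [set w | t * Num.max (Y w) b < Num.max (X w) b]
  [set w | X w <= t * b /\ Y w <= a]
  [set w | t * Num.max (Y w) a < Num.max (X w) a]
  [set w | X w <= t * a /\ Y w <= a].
rewrite !jointW ?mulr_gt0// mulfK ?gt_eqF//= -!/(ratio_tail _ _ _ _ _).
suff h : forall p q x y : R, (p + x <= q + y -> x - y <= q - p).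
  move=> H; apply: h; apply: H; [exact: measurable_ratio_set
    |exact: measurable_quadrant|exact: measurable_ratio_set
    |exact: measurable_quadrant| |].
- rewrite ratio_setE ?(ltW a0, ltW b0)//; apply/seteqP; split=> // w /= [XY [Xb _]].
  have := lt_le_trans XY Xb; rewrite ltr_pM2l// ltNge => /negP; apply.
  by rewrite le_max lexx orbT.
- rewrite !ratio_setE ?(ltW a0, ltW b0)// => w /= [XY|[Xb Ya]].
    left; apply: le_lt_trans XY; rewrite ler_pM2l// ge_max !le_max lexx/=.
    by rewrite (ltW ab) orbT.
  have [Xa|Xa] := leP (X w) (t * a); first by right.
  by left; rewrite /= max_r.
by move=> *; lra.
Qed.

(** A point in the tail event for [a] but not in the one for [b] has [ta < X] and [X > tY]. Then
    [Y <= b], since otherwise it would be in the event for [b], and hence [X <= tb]: the point lies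
    in a rectangle. *)
Lemma ratio_tail_box_le (t a b : R) : 1 <= t -> 0 < a -> a < b ->
  ratio_tail P X Y a t - ratio_tail P X Y b t <=
  expR (- (W t / b)) - expR (- (W (t * a / b) / b)).
Proof.
move=> t1 a0 ab; have b0 := lt_trans a0 ab; have t0 : 0 < t := lt_le_trans ltr01 t1.
have := @fine_probability_subU
  [set w | t * Num.max (Y w) a < Num.max (X w) a]
  [set w | X w <= t * a /\ Y w <= b]
  [set w | t * Num.max (Y w) b < Num.max (X w) b]
  [set w | X w <= t * b /\ Y w <= b].
rewrite !jointW ?mulr_gt0// mulfK ?gt_eqF//= -!/(ratio_tail _ _ _ _ _).
suff h : forall p q x y : R, (p + x <= q + y -> p - q <= y - x).
  move=> H; apply: h; apply: H; [exact: measurable_ratio_set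
    |exact: measurable_quadrant|exact: measurable_ratio_set
    |exact: measurable_quadrant| |].
- rewrite ratio_setE ?(ltW a0, ltW b0)//; apply/seteqP; split=> // w /= [XY [Xa _]].
  have := lt_le_trans XY Xa; rewrite ltr_pM2l// ltNge => /negP; apply.
  by rewrite le_max lexx orbT.
- rewrite !ratio_setE ?(ltW a0, ltW b0)// => w /= [XY|[Xa Yb]]; last first.
    by right; split=> //; rewrite (le_trans Xa)// ler_pM2l// ltW.
  have tY : t * Y w < X w.
    by apply: le_lt_trans XY; rewrite ler_pM2l// le_max lexx.
  have [Yb|Yb] := leP (Y w) b; last by left.
  by have [Xb|Xb] := leP (X w) (t * b); [right | left].
by move=> *; lra.
Qed.

(** The tail event avoids the rectangle [X <= ta], [Y <= a], whose probability tends to [1] as [a]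
    grows. This yields the limit at infinity required on the geometric grid. *)
Lemma ratio_tail_le_1B (t a : R) : 1 <= t -> 0 < a ->
  ratio_tail P X Y a t <= 1 - expR (- (W t / a)).
Proof.
move=> t1 a0; have t0 : 0 < t := lt_le_trans ltr01 t1.
have := @fine_probability_subU
  [set w | t * Num.max (Y w) a < Num.max (X w) a]
  [set w | X w <= t * a /\ Y w <= a] setT set0.
rewrite jointW ?mulr_gt0// mulfK ?gt_eqF//= -!/(ratio_tail _ _ _ _ _).
rewrite probability_setT measure0 /= addr0 => H.
rewrite lerBrDr; apply: H => //.
- exact: measurable_ratio_set.
- exact: measurable_quadrant.
- rewrite ratio_setE ?(ltW a0)//; apply/seteqP; split=> // w /= [XY [Xa _]].
  have := lt_le_trans XY Xa; rewrite ltr_pM2l// ltNge => /negP; apply.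
  by rewrite le_max lexx orbT.
- by rewrite setU0.
Qed.

Lemma expR_div_cvg (c : R) : (fun a => expR (- (c / a))) @ +oo --> (1 : R).
Proof.
rewrite -[X in _ --> X]expR0; apply: continuous_cvg; first exact: continuous_expR.
rewrite -oppr0 -(mulr0 c); apply: cvgN; apply: cvgMl_tmp.
apply/gtr0_cvgV0; last exact: cvg_id.
exact: nbhs_pinfty_gt.
Qed.

Lemma ratio_tail_cvgy (t : R) : 1 <= t ->
  (fun a => ratio_tail P X Y a t) @ +oo --> (0 : R).
Proof.
move=> t1.
have up : (fun a => 1 - expR (- (W t / a))) @ +oo --> (0 : R).
  rewrite -[X in _ --> X](subrr 1); apply: cvgB; first exact: cvg_cst.
  exact: expR_div_cvg.
apply: (squeeze_cvgr _ (cvg_cst 0) up); near=> a.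
rewrite ratio_tail_ge0 ratio_tail_le_1B//; near: a; exact: nbhs_pinfty_gt.
Unshelve. all: by end_near. Qed.

End ratio_tail.

(** * Two-sided bounds of the tail by [gamma_fun] and the limit of their ratio *)

Section tail_asymptotics.
Context (R : realType) (dS : measure_display) (S : measurableType dS).
Context (mu : {measure set S -> \bar R}) (f g : S -> R).
Context (mf : measurable_fun setT f) (mg : measurable_fun setT g).
Context (f0 : forall s, 0 <= f s) (g0 : forall s, 0 <= g s).
Context (intf : (\int[mu]_s (f s)%:E = 1)%E) (intg : (\int[mu]_s (g s)%:E = 1)%E).
Context (dO : measure_display) (Omega : measurableType dO).
Context (P : probability Omega R) (X Y : Omega -> R).
Context (mX : measurable_fun setT X) (mY : measurable_fun setT Y).
Context (joint : forall x y : R, 0 < x -> 0 < y ->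
  P [set w | X w <= x /\ Y w <= y] =
  (expR (- Rintegral mu setT (fun s => Num.max (f s / x) (g s / y))))%:E).

Local Notation W := (exponent mu f g).
Local Notation Q := (excess mu f g).

Let jointW (x y : R) : 0 < x -> 0 < y ->
  P [set w | X w <= x /\ Y w <= y] = (expR (- (W (x / y) / y)))%:E.
Proof. by move=> x0 y0; rewrite joint// exponent_homogeneous. Qed.

Let W_gt0 (t : R) : 0 < t -> 0 < W t.
Proof. by move=> /(exponent_ge1 mf mg f0 g0 intf intg)/(lt_le_trans ltr01). Qed.

(** In [r], the quotient is the slope of the tail increments relative to those of
    [expR (- (W t / a))], and the exponential absorbs the variation of that function within a
    cell. *)
Lemma ratio_tail_ge_grid (t u q : R) : 1 <= t -> 0 < u -> 1 < q ->
  Q (t * q) / (t * W t) * expR (- (W t * (1 - q^-1) / u)) *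
    (1 - expR (- (W t / u))) <= ratio_tail P X Y u t.
Proof.
move=> t1 u0 q1; have t0 : 0 < t := lt_le_trans ltr01 t1.
have q0 : 0 < q := lt_trans ltr01 q1.
have c0 := W_gt0 t0; set c := W t in c0 *.
have Q0 : 0 <= Q (t * q) by exact: excess_ge0.
have d0 : 0 <= 1 - q^-1 by rewrite subr_ge0 invf_le1// ltW.
set r := _ * expR _.
have r0 : 0 <= r by rewrite mulr_ge0 ?expR_ge0// divr_ge0// mulr_ge0 ?ltW.
(* [G] decreases along the grid and tends to [r], so [r <= G u], which rearranges to the claim. *)
pose G a := ratio_tail P X Y a t + r * expR (- (c / a)).
suff: r <= G u by rewrite /G; lra.
apply: (@geometric_grid_le _ _ q u) => // [a ua|]; last first.
  rewrite -[X in _ --> X]add0r -[X in _ --> _ + X]mulr1; apply: cvgD.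
    exact: (ratio_tail_cvgy mX mY jointW).
  by apply: cvgMl_tmp; exact: expR_div_cvg.
have a0 : 0 < a := lt_le_trans u0 ua.
have qa0 : 0 < q * a by rewrite mulr_gt0.
have := ratio_tail_box_ge mX mY jointW t1 a0 (_ : a < q * a).
rewrite ltr_pMl// => /(_ q1).
have -> : t * (q * a) / a = t * q by field; rewrite gt_eqF.
move=> box.
have Wsub : Q (t * q) * (t^-1 - (t * q)^-1) <= c - W (t * q).
  by apply: exponent_sub_ge => //; rewrite ltr_pMr.
have gap : c / a - c / (q * a) = c * (1 - q^-1) / a by field; rewrite !gt_eqF.
(* For [a >= u] the exponents at the two ends of a cell differ by at most [c * (1 - q^-1) / u],
   which is the second factor of [r]. *)
have decay : expR (- (c * (1 - q^-1) / u)) * expR (- (c / (q * a))) <=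
    expR (- (c / a)).
  rewrite -expRD ler_expR -opprD lerN2 -lerBlDr gap.
  by rewrite ler_wpM2l ?mulr_ge0 ?(ltW c0)// lef_pV2.
have low : Q (t * q) * (1 - q^-1) / (t * a) * expR (- (c / a)) <=
    expR (- (W (t * q) / a)) - expR (- (c / a)).
  apply: le_trans (expR_sub_ge _ _); rewrite mulrC ler_wpM2l ?expR_ge0//.
  rewrite opprK [- _ + _]addrC -mulrBl ler_pdivlMr//; apply: le_trans Wsub.
  by rewrite le_eqVlt; apply/orP; left; apply/eqP; field; rewrite !gt_eqF.
have up : r * (expR (- (c / (q * a))) - expR (- (c / a))) <=
    Q (t * q) * (1 - q^-1) / (t * a) * expR (- (c / a)).
  apply: le_trans (ler_wpM2l r0 (expR_sub_le _ _)) _.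
  rewrite opprK [- _ + _]addrC gap.
  apply: le_trans (ler_wpM2l _ decay); last first.
    by rewrite divr_ge0 ?mulr_ge0// ltW.
  rewrite /r -/c le_eqVlt; apply/orP; left; apply/eqP; field.
  by rewrite !gt_eqF.
by rewrite /G; lra.
Qed.

(** With tail level [t * q], the upper rectangle over a cell of ratio [q] brings in [W] at exactly
    [t], so the slope that appears is [Q t]. *)
Lemma ratio_tail_le_grid (t u q : R) : 1 <= t -> 0 < u -> 1 < q ->
  ratio_tail P X Y u (t * q) <=
  Q t / (t * q * W (t * q)) * expR (W (t * q) * (1 - q^-1) / u) *
    (1 - expR (- (W (t * q) / u))).
Proof.
move=> t1 u0 q1; have t0 : 0 < t := lt_le_trans ltr01 t1.
have q0 : 0 < q := lt_trans ltr01 q1.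
have tq1 : 1 <= t * q by rewrite (le_trans t1)// ler_peMr ?ltW.
have tq0 : 0 < t * q by rewrite mulr_gt0.
have c0 := W_gt0 tq0; set c := W (t * q) in c0 *.
have Q0 : 0 <= Q t by exact: excess_ge0.
have d0 : 0 <= 1 - q^-1 by rewrite subr_ge0 invf_le1// ltW.
set r := _ * expR _.
have r0 : 0 <= r by rewrite mulr_ge0 ?expR_ge0// divr_ge0// mulr_ge0 ?ltW.
(* The sign is reversed because here the tail plus the exponential term increases along the grid. *)
pose G a := - (ratio_tail P X Y a (t * q) + r * expR (- (c / a))).
suff: - r <= G u by rewrite /G; lra.
apply: (@geometric_grid_le _ _ q u) => // [a ua|]; last first.
  rewrite -[X in _ --> - X]add0r -[X in _ --> - (_ + X)]mulr1.
  apply: cvgN; apply: cvgD.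
    exact: (ratio_tail_cvgy mX mY jointW).
  by apply: cvgMl_tmp; exact: expR_div_cvg.
have a0 : 0 < a := lt_le_trans u0 ua.
have qa0 : 0 < q * a by rewrite mulr_gt0.
have := ratio_tail_box_le mX mY jointW tq1 a0 (_ : a < q * a).
rewrite ltr_pMl// => /(_ q1).
have -> : t * q * a / (q * a) = t by field; rewrite !gt_eqF.
rewrite -/c => box.
have Wsub : W t - c <= Q t * (t^-1 - (t * q)^-1).
  by apply: exponent_sub_le => //; rewrite ltr_pMr.
have gap : c / a - c / (q * a) = c * (1 - q^-1) / a by field; rewrite !gt_eqF.
have decay : expR (- (c / (q * a))) <=
    expR (c * (1 - q^-1) / u) * expR (- (c / a)).
  rewrite -expRD ler_expR lerBrDr addrC gap.
  by rewrite ler_wpM2l ?mulr_ge0 ?(ltW c0)// lef_pV2.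
have up : expR (- (c / (q * a))) - expR (- (W t / (q * a))) <=
    Q t * (1 - q^-1) / (t * q * a) * expR (- (c / (q * a))).
  apply: le_trans (expR_sub_le _ _) _; rewrite mulrC ler_wpM2r ?expR_ge0//.
  rewrite opprK [- _ + _]addrC -mulrBl ler_pdivrMr//; apply: le_trans Wsub _.
  by rewrite le_eqVlt; apply/orP; left; apply/eqP; field; rewrite !gt_eqF.
have low : Q t * (1 - q^-1) / (t * q * a) * expR (- (c / (q * a))) <=
    r * (expR (- (c / (q * a))) - expR (- (c / a))).
  apply: le_trans (ler_wpM2l r0 (expR_sub_ge _ _)).
  rewrite opprK [- _ + _]addrC gap.
  apply: le_trans (ler_wpM2l _ decay) _.
    by rewrite divr_ge0 ?mulr_ge0// ltW.
  rewrite /r -/c le_eqVlt; apply/orP; left; apply/eqP; field.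
  by rewrite !gt_eqF.
by rewrite /G; lra.
Qed.

Let q (n : nat) : R := 1 + n.+1%:R^-1.

Let q_gt1 (n : nat) : 1 < q n.
Proof. by rewrite /q ltrDl invr_gt0. Qed.

Let q_nonincreasing : {homo q : m n / (m <= n)%N >-> n <= m}.
Proof. by move=> m n mn; rewrite /q lerD2l lef_pV2 ?posrE// ler_nat. Qed.

Let q_cvg1 : q @ \oo --> (1 : R).
Proof.
rewrite -[X in _ --> X]addr0; apply: cvgD; first exact: cvg_cst.
exact: cvg_harmonic.
Qed.

(** The distortion within a cell disappears as the mesh is refined; [c] may have either sign, the
    lower bound using [- W t]. *)
Let expR_mesh_cvg (c u : R) :
  (fun n => expR (c * (1 - (q n)^-1) / u)) @ \oo --> (1 : R).
Proof.
rewrite -[X in _ --> X]expR0; apply: continuous_cvg; first exact: continuous_expR.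
have -> : 0 = c * (1 - 1^-1) / u by rewrite invr1 subrr mulr0 mul0r.
apply: cvgMr_tmp; apply: cvgMl_tmp; apply: cvgB; first exact: cvg_cst.
by apply: cvgV => //; exact: oner_neq0.
Qed.

(** Let [q] decrease to [1] in the grid bound, using right continuity of [Q]. Then replace [W t] by
    its upper bound in the denominator and by its lower bound [1] in the exponential. *)
Lemma ratio_tail_ge (t u : R) : 1 <= t -> 0 < u ->
  gamma_fun mu f g t / (1 + t^-1) * (1 - expR (- u^-1)) <= ratio_tail P X Y u t.
Proof.
move=> t1 u0; have t0 : 0 < t := lt_le_trans ltr01 t1.
have W1 : 1 <= W t by exact: exponent_ge1.
have W2 : W t <= 1 + t^-1 by exact: exponent_le.
have c0 : 0 < W t := W_gt0 t0.
have Q0 : 0 <= Q t by exact: excess_ge0.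
have bound : Q t / (t * W t) * 1 * (1 - expR (- (W t / u))) <=
    ratio_tail P X Y u t.
  have bound_cvg : (fun n => Q (t * q n) / (t * W t) *
      expR (- W t * (1 - (q n)^-1) / u) * (1 - expR (- (W t / u)))) @ \oo -->
      Q t / (t * W t) * 1 * (1 - expR (- (W t / u))).
    apply: cvgMr_tmp; apply: cvgM; last exact: expR_mesh_cvg.
    by apply: cvgMr_tmp; exact: excess_cvg_right.
  apply: (cvgr_to_le bound_cvg); apply: nearW => n.
  by rewrite !mulNr; exact: ratio_tail_ge_grid.
apply: le_trans bound; rewrite mulr1 /gamma_fun -/(excess mu f g t).
apply: ler_pM.
- by rewrite divr_ge0 ?mulr_ge0 ?addr_ge0 ?invr_ge0 ?(ltW t0).
- by rewrite subr_ge0 -expR0 ler_expR oppr_le0 invr_ge0 ltW.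
- rewrite invfM mulrA [t^-1 * _]mulrC ler_wpM2l//.
    by rewrite divr_ge0// ltW.
  by rewrite lef_pV2// posrE (lt_le_trans c0).
- by rewrite lerD2l lerN2 ler_expR lerN2 -[leLHS]mul1r ler_wpM2r// invr_ge0 ltW.
Qed.

(* The grid bound is applied at levels [t * q n] decreasing to [t]: at level [t]
   itself it would involve [{f >= t g}] and miss the ties [{f = t g}]. *)
Lemma ratio_tail_le (t u : R) : 1 <= t -> 0 < u ->
  ratio_tail P X Y u t <=
  gamma_fun mu f g t * (1 - expR (- ((1 + t^-1) / u))).
Proof.
move=> t1 u0; have t0 : 0 < t := lt_le_trans ltr01 t1.
set C := 1 + t^-1.
have Q0 : 0 <= Q t by exact: excess_ge0.
have up_cvg : (fun n => t^-1 * Q t * expR (C * (1 - (q n)^-1) / u) *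
    (1 - expR (- (C / u)))) @ \oo --> t^-1 * Q t * 1 * (1 - expR (- (C / u))).
  by apply: cvgMr_tmp; apply: cvgMl_tmp; exact: expR_mesh_cvg.
have tail_cvg := ratio_tail_cvg_right (P := P) mX mY t0 (ltW u0) q_gt1 q_nonincreasing q_cvg1.
rewrite /gamma_fun -/(excess mu f g t) -[X in X * (1 - _)]mulr1.
apply: (ler_cvg_to tail_cvg up_cvg); apply: nearW => n.
have q0 : 0 < q n := lt_trans ltr01 (q_gt1 n).
have tq0 : 0 < t * q n by rewrite mulr_gt0.
(* The bounds on [W] are inserted before the limit, so no limit of [W (t * q n)] has to be
   computed. *)
have W1 : 1 <= W (t * q n) by exact: exponent_ge1.
have W2 : W (t * q n) <= C.
  apply: le_trans (exponent_le mf mg f0 g0 intf intg tq0) _.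
  by rewrite lerD2l lef_pV2// ler_peMr ?(ltW t0)// ltW.
have c0 := lt_le_trans ltr01 W1.
have d0 : 0 <= 1 - (q n)^-1 by rewrite subr_ge0 invf_le1// ltW.
apply: le_trans (ratio_tail_le_grid t1 u0 (q_gt1 n)) _.
apply: ler_pM.
- by rewrite mulr_ge0 ?expR_ge0// divr_ge0// mulr_ge0 ?ltW.
- by rewrite subr_ge0 -expR0 ler_expR oppr_le0 divr_ge0 ?ltW.
- apply: ler_pM; rewrite ?expR_ge0//.
  + by rewrite divr_ge0// mulr_ge0 ?ltW.
  + rewrite mulrC ler_wpM2r// lef_pV2 ?posrE ?mulr_gt0// -mulrA.
    by rewrite ler_peMr ?(ltW t0)// mulr_ege1// ltW.
  + by rewrite ler_expR ler_wpM2r ?invr_ge0 ?(ltW u0)// ler_wpM2r.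
- by rewrite lerD2l lerN2 ler_expR lerN2 ler_wpM2r// invr_ge0 ltW.
Qed.

(** Let [u] run through [n.+1%:R^-1]: the factor in the lower bound tends to [1], and the one in the
    upper bound never exceeds [1]. *)
Lemma ratio_tail_bounds0 (t : R) : 1 <= t ->
  gamma_fun mu f g t / (1 + t^-1) <= ratio_tail P X Y 0 t <= gamma_fun mu f g t.
Proof.
move=> t1; have t0 : 0 < t := lt_le_trans ltr01 t1.
have gamma0 : 0 <= gamma_fun mu f g t.
  by rewrite mulr_ge0 ?invr_ge0 ?(ltW t0)//; exact: excess_ge0.
have tail_cvg := ratio_tail_cvg0 (P := P) mX mY t1.
have expRN : (fun n => expR (- (n.+1%:R^-1)^-1)) @ \oo --> (0 : R).
  under eq_fun do rewrite invrK.
  apply: (cvg_comp _ _ _ (@cvgr_expR R)).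
  apply/cvgryPge => A; near=> n.
  by apply: (@le_trans _ _ n%:R); [near: n; exact: nbhs_infty_ger | rewrite ler_nat].
apply/andP; split.
- rewrite -[leLHS]mulr1 -[X in _ * X]subr0.
  apply: (ler_cvg_to _ tail_cvg); last first.
    by apply: nearW => n; apply: ratio_tail_ge.
  by apply: cvgMl_tmp; apply: cvgB => //; exact: cvg_cst.
- apply: (cvgr_to_le tail_cvg); apply: nearW => n.
  apply: le_trans (ratio_tail_le t1 _) _; first by rewrite invr_gt0.
  by rewrite ler_piMr// lerBlDr lerDl expR_ge0.
Unshelve. all: by end_near. Qed.

(** Divide the bounds by [gamma_fun] and squeeze as [t^-1] tends to [0]. The constant is [1] for
    [u = 0] and [1 - expR (- u^-1)] otherwise. *)
Lemma ratio_tail_equiv_gamma (u : R) : 0 <= u ->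
  (forall t, 0 < t -> 0 < gamma_fun mu f g t) ->
  exists2 c : R, 0 < c &
    (fun t => ratio_tail P X Y u t / gamma_fun mu f g t) @ +oo --> c.
Proof.
move=> u0 gamma0.
have inv0 : (fun t : R => t^-1) @ +oo --> (0 : R).
  by apply/gtr0_cvgV0 => //; exact: nbhs_pinfty_gt.
have C1 : (fun t : R => 1 + t^-1) @ +oo --> (1 : R).
  by rewrite -[X in _ --> X]addr0; apply: cvgD => //; exact: cvg_cst.
have C1V : (fun t : R => (1 + t^-1)^-1) @ +oo --> (1 : R).
  by rewrite -[X in _ --> X]invr1; apply: cvgV => //; exact: oner_neq0.
move: u0; rewrite le_eqVlt => /predU1P[<-|u0].
  exists 1 => //; apply: (squeeze_cvgr (h := cst 1) _ C1V); last exact: cvg_cst.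
  near=> t.
  have t1 : 1 <= t by near: t; exact: nbhs_pinfty_ge.
  have gt0 := gamma0 _ (lt_le_trans ltr01 t1).
  have /andP[lo hi] := ratio_tail_bounds0 t1.
  by rewrite ler_pdivlMr// ler_pdivrMr// mul1r hi mulrC lo.
exists (1 - expR (- u^-1)).
  by rewrite subr_gt0 -expR0 ltr_expR oppr_lt0 invr_gt0.
have lo_cvg : (fun t : R => (1 + t^-1)^-1 * (1 - expR (- u^-1))) @ +oo -->
    1 - expR (- u^-1).
  by rewrite -[X in _ --> X]mul1r; exact: cvgMr_tmp.
have up_cvg : (fun t : R => 1 - expR (- ((1 + t^-1) / u))) @ +oo -->
    1 - expR (- u^-1).
  apply: cvgB; first exact: cvg_cst.
  apply: continuous_cvg; first exact: continuous_expR.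
  by apply: cvgN; rewrite -[X in _ --> X]mul1r; exact: cvgMr_tmp.
apply: (squeeze_cvgr _ lo_cvg up_cvg); near=> t.
have t1 : 1 <= t by near: t; exact: nbhs_pinfty_ge.
have gt0 := gamma0 _ (lt_le_trans ltr01 t1).
rewrite ler_pdivlMr// ler_pdivrMr//; apply/andP; split.
  by rewrite mulrC mulrA ratio_tail_ge.
by rewrite mulrC ratio_tail_le.
Unshelve. all: by end_near. Qed.

End tail_asymptotics.

Unset Implicit Arguments. Set Strict Implicit.

(** * Equivalence of the three regular variation conditions *)

Theorem theorem1 (R : realType)
  (dS : measure_display) (S : measurableType dS)
  (mu : {measure set S -> \bar R}) (mu_sf : sigma_finite setT mu)
  (f g : S -> R)
  (mf : measurable_fun setT f) (mg : measurable_fun setT g)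
  (f0 : forall s, 0 <= f s) (g0 : forall s, 0 <= g s)
  (intf : (\int[mu]_s (f s)%:E = 1)%E) (intg : (\int[mu]_s (g s)%:E = 1)%E)
  (dO : measure_display) (Omega : measurableType dO) (P : probability Omega R)
  (X Y : Omega -> R) (mX : measurable_fun setT X) (mY : measurable_fun setT Y)
  (joint : forall x y : R, 0 < x -> 0 < y ->
     P [set w | X w <= x /\ Y w <= y] =
     (expR (- Rintegral mu setT (fun s => Num.max (f s / x) (g s / y))))%:E)
  (Epos : forall t : R, 0 < t -> (0%E < mu [set s | t * g s < f s])%O)
  (alpha : R) (alpha0 : 0 <= alpha) :
  ((exists u : R, 0 <= u /\ regvar alpha (ratio_tail P X Y u)) <->
   (forall u : R, 0 <= u -> regvar alpha (ratio_tail P X Y u))) /\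
  ((forall u : R, 0 <= u -> regvar alpha (ratio_tail P X Y u)) <->
   regvar alpha (gamma_fun mu f g)).
Proof.
have gamma_gt0 t : 0 < t -> 0 < gamma_fun mu f g t.
  move=> t0; rewrite /gamma_fun mulr_gt0 ?invr_gt0//.
  exact: excess_gt0 (Epos t t0).
have mpos : measurable [set t : R | 0 < t].
  by rewrite -set_itvoy; exact: measurable_itv.
have mtail u : 0 <= u -> measurable_fun [set t : R | 0 < t] (ratio_tail P X Y u).
  by move=> u0; apply: nonincreasing_measurable => //; exact: ratio_tail_nonincreasing.
have mgamma : measurable_fun [set t : R | 0 < t] (gamma_fun mu f g).
  apply: measurable_funM.
    (* Measurability of the inverse on the positive half-line comes from the power function with
       exponent [-1], which agrees with it there. *)
    apply: (@eq_measurable_fun _ _ _ _ _ (@powR R ^~ (-1))).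
      by move=> t /set_mem/ltW t0; rewrite powR_inv1.
    by apply: measurable_funTS; exact: measurable_powR.
  by apply: nonincreasing_measurable => //; exact: excess_nonincreasing.
(* Each truncation level is compared with [gamma_fun] separately, so passing from one [u] to all
   goes through [gamma_fun]. *)
have tail_gamma u : 0 <= u ->
    regvar alpha (ratio_tail P X Y u) <-> regvar alpha (gamma_fun mu f g).
  move=> u0.
  have [c c0 tail_c] := ratio_tail_equiv_gamma mf mg f0 g0 intf intg mX mY joint u0 gamma_gt0.
  apply: (@regvar_equiv _ _ c) => // [|t _]; first exact: mtail.
  exact: ratio_tail_ge0.
split; split.
- by move=> [u [u0 /(tail_gamma u u0) rv]] v v0; exact/tail_gamma.
- by move=> rv; exists 0; split=> //; exact: rv.
- by move=> rv; apply/(tail_gamma 0) => //; exact: rv.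
- by move=> rv u u0; exact/tail_gamma.
Qed.
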